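(* Let $\overline{A_1A_2A_3}$ be a triangle in the plane over a field of characteristic not two. Then any coloured orthocenter of $\overline{A_1A_2A_3}$ lies on the circumcircles of $\overline{A_1A_2A_3}$ of the other two colours: the blue orthocenter lies on the red and green circumcircles, the red orthocenter lies on the blue and green circumcircles, and the green orthocenter lies on the blue and red circumcircles.
   Context: Work over a fixed field not of characteristic two. A point is an ordered pair $[x,y]$ of field elements. A line is a proportion $\langle a:b:c\rangle$ with $a,b$ not both zero; the point $[x,y]$ lies on it precisely when $ax+by+c=0$. Lines $\langle a_1:b_1:c_1\rangle$ and $\langle a_2:b_2:c_2\rangle$ are blue perpendicular when $a_1a_2+b_1b_2=0$, red perpendicular when $a_1a_2-b_1b_2=0$, and green perpendicular when $a_1b_2+b_1a_2=0$. A triangle $\overline{A_1A_2A_3}$ is a set of three distinct non-collinear points. For each colour, the altitude of that colour from a point $A$ to a line $l$ is the unique line through $A$ perpendicular to $l$ in that colour; the orthocenter of that colour is the common point (which always exists and is unique) of the three altitudes of that colour from the points of the triangle to the opposite lines. A blue, red or green circle is an equation in $x,y$ of the form $(x-x_0)^2+(y-y_0)^2=K$, $(x-x_0)^2-(y-y_0)^2=K$, or $2(x-x_0)(y-y_0)=K$ respectively, with $x_0,y_0,K$ field elements; a point lies on the circle when its coordinates satisfy the equation. The blue, red and green circumcircles of a triangle are the unique blue, red and green circles passing through its three points. *)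

(* Defs.v *)
From HB Require Import structures.
From mathcomp Require Import all_boot all_order all_algebra.
From mathcomp Require Import ring.

Set Implicit Arguments.
Unset Strict Implicit.
Unset Printing Implicit Defensive.

Import GRing.Theory.

Local Open Scope ring_scope.
Local Open Scope quotient_scope.

Inductive colour := Blue | Red | Green.

Definition point (F : fieldType) : Type := (F * F)%type.

(* A line is a class of [triple]s modulo [proportional], i.e. a proportion
   <a:b:c> with a, b not both zero. *)
Definition triple (F : fieldType) : Type :=
  {t : F * F * F | (t.1.1 != 0) || (t.1.2 != 0)}.
HB.instance Definition _ (F : fieldType) := Choice.on (triple F).

Definition proportional (F : fieldType) : rel (triple F) := fun s t =>
  let: (a1, b1, c1) := val s in let: (a2, b2, c2) := val t in
  [&& a1 * b2 == a2 * b1, a1 * c2 == a2 * c1 & b1 * c2 == b2 * c1].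

Section Line.
Variable F : fieldType.

Lemma proportionalP (s t : triple F) :
  reflect (exists2 k : F, k != 0 &
            val t = (k * (val s).1.1, k * (val s).1.2, k * (val s).2))
          (proportional s t).
Proof.
case: s t => [[[a1 b1] c1] /= h1] [[[a2 b2] c2] /= h2].
apply: (iffP and3P) => /= [[/eqP e1 /eqP e2 /eqP e3]|[k k0 [-> -> ->]]]; last first.
  by split; apply/eqP; ring.
have [a0|a0] := eqVneq a1 0.
  move: h1 e1 e2; rewrite a0 eqxx /= !mul0r => b0.
  move/esym/eqP; rewrite mulf_eq0 (negPf b0) orbF => /eqP a20 _.
  move: h2; rewrite a20 eqxx /= => b20.
  exists (b2 / b1); first by rewrite mulf_neq0 ?invr_neq0.
  by rewrite mulr0 divfK // mulrAC -e3 mulrAC divff // mul1r.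
exists (a2 / a1); last first.
  by rewrite divfK // ![a2 / a1 * _]mulrAC -e1 -e2 ![a1 * _ / _]mulrAC divff // !mul1r.
rewrite mulf_neq0 ?invr_neq0 //; apply: contraTneq h2 => a20.
move/eqP: e1; rewrite a20 mul0r mulf_eq0 (negPf a0) /= => /eqP ->.
by rewrite !eqxx.
Qed.

Lemma proportional_equiv : equiv_class_of (@proportional F).
Proof.
split.
- move=> s; apply/proportionalP; exists 1; rewrite ?oner_neq0 // !mul1r.
  by case: (val s) => [[]].
- have sym (s t : triple F) : proportional s t -> proportional t s.
    move=> /proportionalP[k k0 e]; apply/proportionalP; exists k^-1.
      by rewrite invr_eq0.
    by rewrite e /= !mulKf //; case: (val s) => [[]].
  by move=> s t; apply/idP/idP; apply: sym.
- move=> t s u /proportionalP[k k0 e] /proportionalP[m m0 e'].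
  apply/proportionalP; exists (m * k); first by rewrite mulf_neq0.
  by rewrite e' e /= !mulrA.
Qed.

Canonical proportional_equiv_rel := EquivRelPack proportional_equiv.

End Line.

Definition line (F : fieldType) := {eq_quot (@proportional F)}.

Definition mkline (F : fieldType) (a b c : F) (h : (a != 0) || (b != 0)) : line F :=
  \pi_(line F) (exist _ (a, b, c) h : triple F).

(* The next two predicates do not depend on the representative: see
   [on_mkline] and [perp_mkline]. *)
Definition on_line (F : fieldType) (A : point F) (l : line F) : bool :=
  let: (a, b, c) := val (repr l) in a * A.1 + b * A.2 + c == 0.

Definition perp (F : fieldType) (k : colour) (l1 l2 : line F) : bool :=
  let: (a1, b1, _) := val (repr l1) in let: (a2, b2, _) := val (repr l2) in
  match k with
  | Blue => a1 * a2 + b1 * b2 == 0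
  | Red => a1 * a2 - b1 * b2 == 0
  | Green => a1 * b2 + b1 * a2 == 0
  end.

Definition collinear (F : fieldType) (A B C : point F) : Prop :=
  exists l : line F, [/\ on_line A l, on_line B l & on_line C l].

Definition is_triangle (F : fieldType) (A1 A2 A3 : point F) : Prop :=
  [/\ A1 != A2, A2 != A3, A1 != A3 & ~ collinear A1 A2 A3].

(* Such a line m exists and is unique: see [altitude_exists_unique]. *)
Definition is_altitude (F : fieldType) (k : colour) (A : point F) (l m : line F)
  : Prop := on_line A m /\ perp k m l.

(* H lies on the k-altitude from A to the line BC. *)
Definition on_altitude (F : fieldType) (k : colour) (A B C H : point F) : Prop :=
  exists l m : line F,
    [/\ on_line B l, on_line C l, is_altitude k A l m & on_line H m].

(* A triangle has exactly one: see [orthocenter_exists_unique]. *)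
Definition is_orthocenter (F : fieldType) (k : colour) (A1 A2 A3 H : point F)
  : Prop :=
  [/\ on_altitude k A1 A2 A3 H, on_altitude k A2 A3 A1 H
    & on_altitude k A3 A1 A2 H].

(* The equation of colour k with parameters x0 = centre_x, y0 = centre_y and
   K = quadrance. *)
Record circle (k : colour) (F : fieldType) :=
  Circle { centre_x : F; centre_y : F; quadrance : F }.

Definition on_circle (F : fieldType) (k : colour) (A : point F)
    (Z : circle k F) : bool :=
  let x := A.1 - centre_x Z in let y := A.2 - centre_y Z in
  match k with
  | Blue => x ^+ 2 + y ^+ 2 == quadrance Z
  | Red => x ^+ 2 - y ^+ 2 == quadrance Z
  | Green => 2%:R * x * y == quadrance Z
  end.

(* In characteristic not two, a triangle has exactly one of each colour: see
   [circumcircle_exists_unique]. *)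
Definition is_circumcircle (F : fieldType) (k : colour) (A1 A2 A3 : point F)
    (Z : circle k F) : Prop :=
  [/\ on_circle A1 Z, on_circle A2 Z & on_circle A3 Z].

Section Existence.
Variable F : fieldType.
Implicit Types (A B C H : point F) (l m : line F) (k : colour).

Lemma lineP l : exists a b c h, l = @mkline F a b c h.
Proof.
rewrite -[l]reprK; case: (repr l) => [[[a b] c] h].
by exists a, b, c, h.
Qed.

Lemma repr_mkline a b c h :
  exists2 t : F, t != 0 & val (repr (@mkline F a b c h)) = (t * a, t * b, t * c).
Proof.
have : proportional (exist _ (a, b, c) h : triple F) (repr (mkline c h)).
  by apply/(eqmodP (proportional_equiv_rel F)); rewrite reprK.
by case/proportionalP => t t0 /= ->; exists t.
Qed.

Lemma eq_mkline a b c h a' b' c' h' :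
  (@mkline F a b c h == @mkline F a' b' c' h') =
  [&& a * b' == a' * b, a * c' == a' * c & b * c' == b' * c].
Proof. exact: eqmodE. Qed.

Lemma on_mkline A a b c h :
  on_line A (@mkline F a b c h) = (a * A.1 + b * A.2 + c == 0).
Proof.
rewrite /on_line; have [t t0 ->] := repr_mkline c h.
by rewrite -!mulrA -!mulrDr mulf_eq0 (negPf t0).
Qed.

Definition normal_form k (a1 b1 a2 b2 : F) :=
  match k with
  | Blue => a1 * a2 + b1 * b2
  | Red => a1 * a2 - b1 * b2
  | Green => a1 * b2 + b1 * a2
  end.

Lemma perp_mkline k a b c h a' b' c' h' :
  perp k (@mkline F a b c h) (@mkline F a' b' c' h') =
  (normal_form k a b a' b' == 0).
Proof.
rewrite /perp; have [t t0 ->] := repr_mkline c h.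
have [s s0 ->] := repr_mkline c' h'.
have ts : t * s != 0 by rewrite mulf_neq0.
rewrite -[RHS](mulrI_eq0 _ (mulfI ts)).
by case: k => /=; congr (_ == 0); ring.
Qed.

Lemma orthogonal_dir (a b u v : F) : (a != 0) || (b != 0) -> a * u + b * v = 0 ->
  exists t, u = - (t * b) /\ v = t * a.
Proof.
move=> h e; have [a0|a0] := eqVneq a 0.
  move: h e; rewrite a0 eqxx /= mul0r add0r => b0 /eqP.
  rewrite mulf_eq0 (negPf b0) /= => /eqP ->.
  by exists (- (u / b)); rewrite mulNr divfK // opprK mulr0.
exists (v / a); split; last by rewrite divfK.
have -> : u = (a * u) / a by rewrite mulrAC divff ?mul1r.
have -> : a * u = - (b * v) by apply/eqP; rewrite -addr_eq0 e.
by field.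
Qed.

Lemma line_eq a b c h a' b' c' h' A (t : F) :
  on_line A (@mkline F a b c h) -> on_line A (@mkline F a' b' c' h') ->
  a' = t * a -> b' = t * b -> mkline c h = mkline c' h'.
Proof.
rewrite !on_mkline !addr_eq0 => /eqP e /eqP e' ea eb.
have [ec ec'] : c = - (a * A.1 + b * A.2) /\ c' = - (a' * A.1 + b' * A.2).
  by rewrite e e' !opprK.
apply/eqP; rewrite eq_mkline ec ec' ea eb.
by apply/and3P; split; apply/eqP; ring.
Qed.

Lemma neq_dir A B : A != B -> (A.2 - B.2 != 0) || (B.1 - A.1 != 0).
Proof.
rewrite !subr_eq0; apply: contraNT; rewrite negb_or !negbK => /andP[/eqP e /eqP e'].
by case: A B e e' => [? ?] [? ?] /= -> ->.
Qed.

Lemma join_exists_unique A B : A != B -> exists! l, on_line A l /\ on_line B l.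
Proof.
move=> AB; set l := mkline (A.1 * B.2 - B.1 * A.2) (neq_dir AB).
have Al : on_line A l by rewrite on_mkline; apply/eqP; ring.
have Bl : on_line B l by rewrite on_mkline; apply/eqP; ring.
exists l; split=> // l' [].
have [a [b [c [h ->]]]] := lineP l'.
move=> Al' Bl'; move: (Al') (Bl'); rewrite !on_mkline => /eqP e /eqP e'.
have e0 : a * (B.1 - A.1) + b * (B.2 - A.2) = 0.
  by rewrite -[RHS](subrr 0) -{1}e' -e; ring.
have [t [e1 e2]] := orthogonal_dir h e0.
apply/esym/(line_eq (t := - t) Al' Al); first by rewrite mulNr -e2 opprB.
by rewrite mulNr e1.
Qed.

(* Coefficients of the k-perpendicular to a line with coefficients a, b. *)
Definition perp_a k (a b : F) :=
  match k with Blue => - b | Red => b | Green => a end.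
Definition perp_b k (a b : F) :=
  match k with Blue => a | Red => a | Green => - b end.

Lemma perp_neq0 k a b : (a != 0) || (b != 0) ->
  (perp_a k a b != 0) || (perp_b k a b != 0).
Proof. by case: k => /=; rewrite ?oppr_eq0 // orbC. Qed.

Lemma altitude_exists_unique k A l : exists! m, is_altitude k A l m.
Proof.
have [a [b [c [h ->]]]] := lineP l.
set m := mkline (- (perp_a k a b * A.1 + perp_b k a b * A.2)) (perp_neq0 k h).
have Am : on_line A m by rewrite on_mkline subrr.
exists m; split.
  by split=> //; rewrite perp_mkline; case: (k) => /=; apply/eqP; ring.
move=> m' []; have [a' [b' [c' [h' ->]]]] := lineP m'.
move=> Am'; rewrite perp_mkline => /eqP e.
have : exists t, a' = t * perp_a k a b /\ b' = t * perp_b k a b.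
  case: (k) e => /= e.
  - have e0 : a * a' + b * b' = 0 by rewrite -e; ring.
    by have [t [-> ->]] := orthogonal_dir h e0; exists t; rewrite mulrN.
  - have e0 : a * a' + b * - b' = 0 by rewrite -e; ring.
    have [t [-> e1]] := orthogonal_dir h e0; exists (- t).
    by rewrite !mulNr -e1 opprK.
  - have e0 : a * b' + b * a' = 0 by rewrite -e; ring.
    by have [t [-> ->]] := orthogonal_dir h e0; exists t; rewrite mulrN.
by case=> t [ea eb]; apply: (line_eq Am Am' ea eb).
Qed.

Lemma on_altitudeE k A B C H : B != C ->
  on_altitude k A B C H <->
  normal_form k (C.1 - B.1) (C.2 - B.2) (H.1 - A.1) (H.2 - A.2) = 0.
Proof.
move=> BC; split.
  case=> l [m []]; have [a [b [c [h ->]]]] := lineP l.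
  have [a' [b' [c' [h' ->]]]] := lineP m; rewrite /is_altitude perp_mkline !on_mkline.
  move=> /eqP eB /eqP eC [/eqP eA /eqP ep] /eqP eH.
  have e0 : a * (C.1 - B.1) + b * (C.2 - B.2) = 0.
    by rewrite -[RHS](subrr 0) -{1}eC -eB; ring.
  have e1 : a' * (H.1 - A.1) + b' * (H.2 - A.2) = 0.
    by rewrite -[RHS](subrr 0) -{1}eH -eA; ring.
  have [t [-> ->]] := orthogonal_dir h e0.
  have [s [-> ->]] := orthogonal_dir h' e1.
  transitivity ((if k is Blue then 1 else -1) * t * s * normal_form k a' b' a b).
    by case: (k) => /=; ring.
  by rewrite ep mulr0.
set l := mkline (B.1 * C.2 - C.1 * B.2) (neq_dir BC).
set a := B.2 - C.2; set b := C.1 - B.1 => e.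
set m := mkline (- (perp_a k a b * A.1 + perp_b k a b * A.2))
                (perp_neq0 k (neq_dir BC)).
exists l, m; split.
- by rewrite on_mkline; apply/eqP; ring.
- by rewrite on_mkline; apply/eqP; ring.
- split; first by rewrite on_mkline subrr.
  by rewrite perp_mkline; case: (k) => /=; apply/eqP; ring.
- rewrite on_mkline; move: e; rewrite /a /b; case: (k) => /= e; apply/eqP.
  + by rewrite -[RHS]oppr0 -[in RHS]e; ring.
  + by rewrite -[in RHS]e; ring.
  + by rewrite -[RHS]oppr0 -[in RHS]e; ring.
Qed.

Definition tri_det A B C : F :=
  (B.1 - A.1) * (C.2 - A.2) - (C.1 - A.1) * (B.2 - A.2).

Lemma tri_det_neq0 A1 A2 A3 : is_triangle A1 A2 A3 -> tri_det A1 A2 A3 != 0.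
Proof.
case=> h _ _ nc; apply/eqP => e; apply: nc.
exists (mkline (A1.1 * A2.2 - A2.1 * A1.2) (neq_dir h)).
rewrite !on_mkline; split; apply/eqP; [ring | ring |].
by rewrite -e /tri_det; ring.
Qed.

Lemma cramer (p q r s e f : F) : p * s - q * r != 0 ->
  exists! X : F * F, p * X.1 + q * X.2 = e /\ r * X.1 + s * X.2 = f.
Proof.
set d := _ - _ => d0.
exists ((e * s - q * f) / d, (p * f - r * e) / d); split => /=.
  by split; rewrite !mulrA -mulrDl; apply: (canLR (mulfK d0)); rewrite /d; ring.
case=> x y /= [<- <-]; congr pair; apply: (canLR (mulfK d0)); rewrite /d; ring.
Qed.

Lemma exists_unique_iff (T : Type) (P Q : T -> Prop) :
  (forall x, P x <-> Q x) -> (exists! x, P x) -> exists! x, Q x.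
Proof.
move=> PQ [x [Px ux]]; exists x; split; first exact/PQ.
by move=> y /PQ; apply: ux.
Qed.

Lemma orthocenter_exists_unique k A1 A2 A3 :
  is_triangle A1 A2 A3 -> exists! H, is_orthocenter k A1 A2 A3 H.
Proof.
move=> T; have d0 := tri_det_neq0 T; have [n12 n23 n13 _] := T.
pose u := normal_form k (A3.1 - A2.1) (A3.2 - A2.2).
pose v := normal_form k (A1.1 - A3.1) (A1.2 - A3.2).
pose w := normal_form k (A2.1 - A1.1) (A2.2 - A1.2).
have D0 : u 1 0 * v 0 1 - u 0 1 * v 1 0 != 0.
  suff [->|->] : u 1 0 * v 0 1 - u 0 1 * v 1 0 = tri_det A1 A2 A3 \/
    u 1 0 * v 0 1 - u 0 1 * v 1 0 = - tri_det A1 A2 A3 by rewrite ?oppr_eq0.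
  by rewrite /u /v /tri_det; case: (k) => /=; [left | right | right]; ring.
apply: exists_unique_iff (cramer (u A1.1 A1.2) (v A2.1 A2.2) D0) => H.
rewrite /is_orthocenter.
have uE : u (H.1 - A1.1) (H.2 - A1.2) =
    u 1 0 * H.1 + u 0 1 * H.2 - u A1.1 A1.2 by rewrite /u; case: (k) => /=; ring.
have vE : v (H.1 - A2.1) (H.2 - A2.2) =
    v 1 0 * H.1 + v 0 1 * H.2 - v A2.1 A2.2 by rewrite /v; case: (k) => /=; ring.
have wE : w (H.1 - A3.1) (H.2 - A3.2) =
    - u (H.1 - A1.1) (H.2 - A1.2) - v (H.1 - A2.1) (H.2 - A2.2).
  by rewrite /u /v /w; case: (k) => /=; ring.
split=> [[eu ev]|[]].
  have u0 : u (H.1 - A1.1) (H.2 - A1.2) = 0 by rewrite uE eu subrr.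
  have v0 : v (H.1 - A2.1) (H.2 - A2.2) = 0 by rewrite vE ev subrr.
  split; apply/on_altitudeE => //; first by rewrite eq_sym.
  by rewrite -/w wE u0 v0 oppr0 addr0.
have n31 : A3 != A1 by rewrite eq_sym.
move=> /(on_altitudeE _ _ _ n23) + /(on_altitudeE _ _ _ n31) + _.
rewrite -/u -/v uE vE => /eqP; rewrite subr_eq0 => /eqP -> /eqP.
by rewrite subr_eq0 => /eqP ->.
Qed.

Lemma circumcircle_exists_unique k A1 A2 A3 : 2%N \notin [pchar F] ->
  is_triangle A1 A2 A3 -> exists! Z : circle k F, is_circumcircle A1 A2 A3 Z.
Proof.
move=> ch2 T; have d0 := tri_det_neq0 T.
have two : 2%:R != 0 :> F by move: ch2; rewrite inE.
pose Q (x y : F) := normal_form k x y x y.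
have QE A (Z : circle k F) : on_circle A Z =
    (Q (A.1 - centre_x Z) (A.2 - centre_y Z) == quadrance Z).
  rewrite /on_circle /Q; move: (A.1 - _) (A.2 - _) (quadrance Z) => x y q.
  by case: (k) => /=; congr (_ == _); ring.
pose u := normal_form k (A2.1 - A1.1) (A2.2 - A1.2).
pose v := normal_form k (A3.1 - A1.1) (A3.2 - A1.2).
have D0 : (2%:R * u 1 0) * (2%:R * v 0 1) - (2%:R * u 0 1) * (2%:R * v 1 0) != 0.
  set D := _ - _; have d4 : 2%:R * 2%:R * tri_det A1 A2 A3 != 0 by rewrite !mulf_neq0.
  suff [->|->] : D = 2%:R * 2%:R * tri_det A1 A2 A3 \/
    D = - (2%:R * 2%:R * tri_det A1 A2 A3) by rewrite ?oppr_eq0.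
  by rewrite /D /u /v /tri_det; case: (k) => /=; [left | right | right]; ring.
have [X [[e f] uX]] := cramer (Q A2.1 A2.2 - Q A1.1 A1.2)
  (Q A3.1 A3.2 - Q A1.1 A1.2) D0.
have E2 x y : Q (A2.1 - x) (A2.2 - y) - Q (A1.1 - x) (A1.2 - y) =
    Q A2.1 A2.2 - Q A1.1 A1.2 - (2%:R * u 1 0 * x + 2%:R * u 0 1 * y).
  by rewrite /Q /u; case: (k) => /=; ring.
have E3 x y : Q (A3.1 - x) (A3.2 - y) - Q (A1.1 - x) (A1.2 - y) =
    Q A3.1 A3.2 - Q A1.1 A1.2 - (2%:R * v 1 0 * x + 2%:R * v 0 1 * y).
  by rewrite /Q /v; case: (k) => /=; ring.
exists (Circle k X.1 X.2 (Q (A1.1 - X.1) (A1.2 - X.2))); split.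
  split; rewrite QE //= -subr_eq0; [by rewrite E2 e subrr | by rewrite E3 f subrr].
case=> x y K [/= + + +]; rewrite !QE /= => /eqP <-.
rewrite -subr_eq0 E2 subr_eq0 => /eqP e2; rewrite -subr_eq0 E3 subr_eq0 => /eqP e3.
by rewrite (uX (x, y)).
Qed.

End Existence.

(* Main.v *)
Require Import Defs.
From mathcomp Require Import all_boot all_order all_algebra.
From mathcomp Require Import ring.
Import GRing.Theory.
Set Implicit Arguments.
Unset Strict Implicit.

Local Open Scope ring_scope.

(* Write N for the bilinear form of colour k and N' for that of another colour
   k'.  These forms are apolar:
     N(a,a) N'(b,b) + N(b,b) N'(a,a) = 2 N(a,b) N'(a,b).
   Put A1 at the origin, with a, b, h the vectors to A2, A3 and the
   k-orthocenter.  The altitudes give N(h,a) = N(h,b) = N(a,b) = n, so that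
     G h = n (N(b,b) - n) a + n (N(a,a) - n) b,   G = N(a,a) N(b,b) - n^2.
   A k'-circle through the origin has an equation N'(x,x) = N'(x,d).  As it
   holds at a and b, bilinearity turns both sides at G h into combinations of
   N'(a,a), N'(b,b) and N'(a,b), and apolarity eliminates N'(a,b). *)

Definition dot {F : fieldType} (k : colour) (u v : point F) : F :=
  normal_form k u.1 u.2 v.1 v.2.

Definition vec {F : fieldType} (A B : point F) : point F :=
  (B.1 - A.1, B.2 - A.2).

Definition lincomb {F : fieldType} (p q : F) (u v : point F) : point F :=
  (p * u.1 + q * v.1, p * u.2 + q * v.2).

Definition gram {F : fieldType} (k : colour) (a b : point F) : F :=
  dot k a a * dot k b b - dot k a b ^+ 2.

Lemma dot_apolar (F : fieldType) (k k' : colour) (a b : point F) : k <> k' ->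
  2%:R * dot k a b * dot k' a b =
  dot k a a * dot k' b b + dot k b b * dot k' a a.
Proof. by rewrite /dot; case: k; case: k' => //= _; ring. Qed.

Lemma dot_lincombl (F : fieldType) (k : colour) (p q : F) (u v w : point F) :
  dot k (lincomb p q u v) w = p * dot k u w + q * dot k v w.
Proof. by rewrite /dot; case: k => /=; ring. Qed.

Lemma dot_lincomb_sq (F : fieldType) (k : colour) (p q : F) (u v : point F) :
  dot k (lincomb p q u v) (lincomb p q u v) =
  p ^+ 2 * dot k u u + 2%:R * p * q * dot k u v + q ^+ 2 * dot k v v.
Proof. by rewrite /dot; case: k => /=; ring. Qed.

(** Cramer's rule recovers [h] from its products with [a] and [b]; the left side is just [h] scaled
    by [gram k a b]. *)
Lemma gram_expand (F : fieldType) (k : colour) (a b h : point F) :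
  lincomb (gram k a b) 0 h h =
  lincomb (dot k h a * dot k b b - dot k h b * dot k a b)
          (dot k h b * dot k a a - dot k h a * dot k a b) a b.
Proof. by rewrite /lincomb /gram /dot; congr pair; case: k => /=; ring. Qed.

(** A Gram determinant is the determinant of the form, here 1 or -1, times the squared determinant
    of the two vectors. *)
Lemma gram_neq0 (F : fieldType) (k : colour) (A1 A2 A3 : point F) :
  is_triangle A1 A2 A3 -> gram k (vec A1 A2) (vec A1 A3) != 0.
Proof.
move=> /tri_det_neq0 D0.
have -> : gram k (vec A1 A2) (vec A1 A3) =
    (if k is Blue then 1 else -1) * tri_det A1 A2 A3 ^+ 2.
  by rewrite /gram /dot /tri_det; case: k => /=; ring.
by rewrite mulf_neq0 ?expf_neq0 //; case: k; rewrite ?oppr_eq0 oner_neq0.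
Qed.

Lemma orthocenter_dot (F : fieldType) (k : colour) (A1 A2 A3 H : point F) :
  is_triangle A1 A2 A3 -> is_orthocenter k A1 A2 A3 H ->
  let n := dot k (vec A1 A2) (vec A1 A3) in
  dot k (vec A1 H) (vec A1 A2) = n /\ dot k (vec A1 H) (vec A1 A3) = n.
Proof.
case=> n12 _ n13 _ [_ alt2 alt3].
have n31 : A3 != A1 by rewrite eq_sym.
move: alt2 alt3 => /(on_altitudeE _ _ _ n31) e2 /(on_altitudeE _ _ _ n12) e3.
split; apply/eqP; rewrite -subr_eq0; apply/eqP.
  (* With a, b, h from [A1], the altitude from [A3] says N(a, h - b) = 0; the one from [A2] says
     N(b, h - a) = 0. *)
  by rewrite -[RHS]e3 /dot; case: (k) => /=; ring.
by rewrite -[RHS]oppr0 -[in RHS]e2 /dot; case: (k) => /=; ring.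
Qed.

Lemma dot_orthocenter (F : fieldType) (k k' : colour) (a b h d : point F) :
  k <> k' -> gram k a b != 0 ->
  dot k h a = dot k a b -> dot k h b = dot k a b ->
  dot k' a a = dot k' a d -> dot k' b b = dot k' b d ->
  dot k' h h = dot k' h d.
Proof.
move=> kk' G0 ha hb ea eb; have := gram_expand k a b h; rewrite ha hb.
set p := _ - _; set q := _ - _ => e.
have eG : gram k a b * dot k' h d = p * dot k' a a + q * dot k' b b.
  by rewrite ea eb -dot_lincombl -e dot_lincombl mul0r addr0.
(* Scaling by the squared Gram determinant makes the left side the [k'] form at G h. *)
apply: (mulfI (expf_neq0 2 G0)); rewrite [in RHS]expr2 -mulrA eG.
transitivity (dot k' (lincomb p q a b) (lincomb p q a b)).
  by rewrite -e dot_lincomb_sq; ring.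
rewrite dot_lincomb_sq.
(* [p] has the factor [dot k a b], which the cross term needs for apolarity; [m] is the cofactor. *)
set m := (dot k b b - dot k a b) * q.
have -> : 2%:R * p * q * dot k' a b = m * (2%:R * dot k a b * dot k' a b).
  by rewrite /m /p; ring.
by rewrite (dot_apolar _ _ kk') /m /p /q /gram; ring.
Qed.

Lemma on_circle_dot (F : fieldType) (k : colour) (O : point F)
    (Z : circle k F) :
  on_circle O Z -> exists d : point F, forall A,
    on_circle A Z = (dot k (vec O A) (vec O A) == dot k (vec O A) d).
Proof.
have onE A : on_circle A Z =
    (dot k (vec (centre_x Z, centre_y Z) A) (vec (centre_x Z, centre_y Z) A)
      == quadrance Z).
  by rewrite /on_circle /dot; case: (k) Z => Z /=; congr (_ == _); ring.
rewrite onE => /eqP KO.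
(* For c the centre seen from [O], N(x - c, x - c) = N(c, c) reads N(x, x) = N(x, 2c). *)
exists (2%:R * (centre_x Z - O.1), 2%:R * (centre_y Z - O.2)) => A.
rewrite onE -KO -subr_eq0 -[RHS]subr_eq0; congr (_ == _).
by rewrite /dot; case: (k) Z {onE KO} => Z /=; ring.
Qed.

Theorem theorem22 (F : fieldType) (charF : 2%N \notin [pchar F])
    (A1 A2 A3 : point F) (tri : is_triangle A1 A2 A3)
    (k k' : colour) (kk' : k <> k')
    (H : point F) (orthoH : is_orthocenter k A1 A2 A3 H)
    (Z : circle k' F) (circumZ : is_circumcircle A1 A2 A3 Z) :
  on_circle H Z.
Proof.
case: circumZ => /on_circle_dot[d onE]; rewrite !onE => /eqP e2 /eqP e3.
have [h2 h3] := orthocenter_dot tri orthoH.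
exact/eqP/(dot_orthocenter kk' (gram_neq0 k tri) h2 h3 e2 e3).
Qed.
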